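(* Let $g \in L^2(\mathbb{R}^d,\mathbb{R})$ be a real-valued window function and let $\mathcal{L} = \mathcal{A}\times\mathcal{B} \subseteq \mathbb{R}^{2d}$ be a separable lattice, where $\mathcal{A},\mathcal{B}$ are lattices in $\mathbb{R}^d$. Then there exist $f_1,f_2 \in L^2(\mathbb{R}^d)$ which satisfy all of the following: (1) $|V_g f_1(z)|=|V_g f_2(z)|$ for all $z \in \mathcal{L}$; (2) $|f_1(t)| = |f_2(t)|$ for all $t \in \mathbb{R}^d$; (3) there is no $\nu\in\mathbb{C}$ with $|\nu|=1$ and $f_1=\nu f_2$.
   Context: $V_gf(x,\omega)=\int_{\mathbb{R}^d} f(t)\overline{g(t-x)}e^{-2\pi i \omega\cdot t}\,dt$ is the short-time Fourier transform. A lattice in $\mathbb{R}^d$ is $A\mathbb{Z}^d$ with $A\in\mathrm{GL}_d(\mathbb{R})$. $L^2(\mathbb{R}^d,\mathbb{R})$ denotes the real-valued functions in $L^2(\mathbb{R}^d)$. *)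

(* Defs.v *)
From mathcomp Require Import all_boot all_algebra.
From mathcomp Require Import all_classical all_reals all_analysis.
From mathcomp Require Import complex.
Import GRing.Theory Num.Theory numFieldNormedType.Exports.

Set Implicit Arguments.
Unset Strict Implicit.
Unset Printing Implicit Defensive.

Local Open Scope ring_scope.
Local Open Scope classical_set_scope.
Local Open Scope complex_scope.

Section TF.
Context {R : realType}.

Definition dotv (d : nat) (u v : 'rV[R]_d) : R := \sum_(i < d) u ord0 i * v ord0 i.

Definition borel_fun (d : nat) (h : 'rV[R]_d -> R) : Prop :=
  forall U : set R, open U ->
    <<s [set A : set 'rV[R]_d | open A] >> (h @^-1` U).

(* Lebesgue integral over R^d, written as the iterated one-dimensional
   Lebesgue integral  \int dt_1 \int dt_2 ... \int dt_d  h(t_1,...,t_d).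
   (R^0 is a point, carrying the Dirac mass.)  For the integrands used below
   (nonnegative measurable functions, or integrable functions) this agrees
   with the Lebesgue integral on R^d by Tonelli/Fubini. *)
Fixpoint iint (d : nat) : ('rV[R]_d -> \bar R) -> \bar R :=
  match d return ('rV[R]_d -> \bar R) -> \bar R with
  | 0 => fun h => h 0
  | d'.+1 => fun h =>
      (\int[@lebesgue_measure R]_x iint (fun v : 'rV[R]_d' =>
            h (row_mx (const_mx x : 'rV[R]_1) v)))%E
  end.

Definition sqmod (z : R[i]) : R := complex.Re z ^+ 2 + complex.Im z ^+ 2.

Definition L2 (d : nat) (f : 'rV[R]_d -> R[i]) : Prop :=
  [/\ borel_fun (fun t => complex.Re (f t)), borel_fun (fun t => complex.Im (f t)) &
      (iint (fun t => (sqmod (f t))%:E) < +oo)%E].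

Definition L2real (d : nat) (g : 'rV[R]_d -> R) : Prop :=
  borel_fun g /\ (iint (fun t => (g t ^+ 2)%:E) < +oo)%E.

(* Short-time Fourier transform with a real-valued window g:
   V_g f(x,w) = \int f(t) conj(g(t-x)) e^{-2 pi i w.t} dt,
   split into real and imaginary parts (g real, so conj(g) = g):
   f(t) e^{-i th} = (Re f cos th + Im f sin th) + i (Im f cos th - Re f sin th). *)
Definition stft (d : nat) (g : 'rV[R]_d -> R) (f : 'rV[R]_d -> R[i])
    (x w : 'rV[R]_d) : R[i] :=
  let th := fun t => 2 * pi * dotv w t in
  (fine (iint (fun t =>
     (g (t - x) * (complex.Re (f t) * cos (th t) + complex.Im (f t) * sin (th t)))%:E)))
  +i*
  (fine (iint (fun t =>
     (g (t - x) * (complex.Im (f t) * cos (th t) - complex.Re (f t) * sin (th t)))%:E))).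

(* the point A k of the lattice A Z^d (k an integer vector); points are row
   vectors, so this is k *m A. *)
Definition latpt (d : nat) (A : 'M[R]_d) (k : 'rV[int]_d) : 'rV[R]_d :=
  map_mx (fun z : int => z%:~R) k *m A.

End TF.

(* Main.v *)
From HB Require Import structures.
Require Import Defs.
From mathcomp Require Import all_boot all_order all_algebra.
From mathcomp Require Import all_classical all_reals all_analysis.
From mathcomp Require Import measurable_realfun complex ring lra.
Import Order.TTheory GRing.Theory Num.Theory numFieldNormedType.Exports.
Local Open Scope ring_scope.
Local Open Scope classical_set_scope.
Local Open Scope complex_scope.

Set Implicit Arguments.
Unset Strict Implicit.
Unset Printing Implicit Defensive.

(** Put [f1(t) = g(-t) + i g(v-t)] and [f2 = conj f1], where [v] lies in the dual
    lattice of [B Z^d].  The function [g(t-x) g(c-t)] is invariant under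
    [t |-> x+c-t], and for [w] in [B Z^d] and [c = 0] or [c = v] this reflection
    turns [2 pi w.t] into [2 pi w.x - 2 pi w.t] modulo [2 pi].  Hence for both
    values of [c] the STFT of [g(c-t)] at [(x,w)] is a real multiple of the same
    phase [exp(-i pi w.x)], and [a + i b] and [a - i b] have equal
    moduli when [a] and [b] are real multiples of a common phase.  If [g] is not
    null, then [f1 = nu f2] would force [|<g, T_v g>| = ||g||^2], which fails for
    [v] long because the two translates are almost disjoint.  If [g] is null,
    every STFT vanishes and the same pair is built from the indicator of the
    unit cube instead. *)

(** * Borel functions on R^d *)

Section BorelMeasurability.
Context {R : realType}.

Definition coords_meas disp (S : measurableType disp) (d : nat)
    (p : S -> 'rV[R]_d) : Prop :=
  forall i, measurable_fun setT (fun s => p s ord0 i).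

(* Measurability of a function on [R^d] tested along all families of points
   with measurable coordinates; unlike [borel_fun] it composes and slices
   without mentioning a sigma-algebra on row vectors. *)
Definition rmeas (d : nat) (F : 'rV[R]_d -> R) : Prop :=
  forall disp (S : measurableType disp) (p : S -> 'rV[R]_d),
    coords_meas p -> measurable_fun setT (fun s => F (p s)).

Lemma rat_approx (x r : R) : 0 < r -> exists q : rat, `|ratr q - x| < r.
Proof.
move=> r0; have [|q] := @rat_in_itvoo R (x - r) (x + r); first by lra.
rewrite in_itv /= => /andP[q1 q2]; exists q.
by rewrite ltr_norml; apply/andP; split; lra.
Qed.

(** An open set is the union of the countably many boxes [bx j] (rational centre, radius [1/(k+1)])
    that it contains, and the preimage of a box is a finite intersection of coordinate preimages. *)
Lemma open_coords_meas disp (S : measurableType disp) d (p : S -> 'rV[R]_d)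
    (U : set 'rV[R]_d) :
  coords_meas p -> open U -> measurable (p @^-1` U).
Proof.
move=> mp oU.
pose bx (j : 'rV[rat]_d * nat) : set 'rV[R]_d :=
  [set v | forall i, `|ratr (j.1 ord0 i) - v ord0 i| < j.2.+1%:R^-1].
pose D := [set j | bx j `<=` U].
have -> : p @^-1` U = \bigcup_(j in D) (p @^-1` bx j).
  apply/seteqP; split=> [s /= Ups|s [j Dj] /=]; last exact: Dj.
  have [e /= e0 eU] := (nbhs_ballP _ _).1 (open_nbhs_nbhs (conj oU Ups)).
  (* A rational centre within [1/(k+1)] of [p s] gives a box of points within [2/(k+1) < e] of
     [p s]. *)
  have [k ke] : exists k : nat, k.+1%:R^-1 < e / 2.
    have [k hk] := @ltr_add_invr R 0 (e / 2) ltac:(by rewrite divr_gt0).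
    by exists k; rewrite add0r in hk.
  have /choice [q qP] : forall i : 'I_d, exists q : rat,
      `|ratr q - p s ord0 i| < k.+1%:R^-1 :> R.
    by move=> i; apply: rat_approx; rewrite invr_gt0.
  exists (\row_i q i, k); last by move=> i; rewrite mxE.
  move=> v bv; apply: eU; split=> // i0 i; rewrite ord1 /ball /=.
  have := bv i; rewrite /= mxE => h1; have h2 := qP i.
  have -> : p s ord0 i - v ord0 i =
    (ratr (q i) - v ord0 i) - (ratr (q i) - p s ord0 i) by ring.
  apply: le_lt_trans (ler_normB _ _) _.
  by move: (k.+1%:R^-1) h1 h2 ke => r; lra.
have -> : \bigcup_(j in D) (p @^-1` bx j) =
    \bigcup_j (if `[< D j >] then p @^-1` bx j else set0).
  apply/seteqP; split=> s [j].
    by move=> Dj bj; exists j => //; rewrite asboolT.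
  by move=> _; case: asboolP => // Dj bj; exists j.
apply: countable_bigcupT_measurable => // j.
case: asboolP => // _.
have -> : p @^-1` bx j =
    \bigcap_(i in [set: 'I_d]) [set s | p s ord0 i \in
       `]ratr (j.1 ord0 i) - j.2.+1%:R^-1, ratr (j.1 ord0 i) + j.2.+1%:R^-1[%R].
  apply/seteqP; split=> s /=.
    by move=> h i _ /=; have := h i; rewrite in_itv/= ltr_distlC.
  by move=> h i; have /= := h i I; rewrite in_itv/= ltr_distlC.
apply: fin_bigcap_measurable => // i _.
have := mp i measurableT _ (measurable_itv `]ratr (j.1 ord0 i) - j.2.+1%:R^-1,
  ratr (j.1 ord0 i) + j.2.+1%:R^-1[%R).
by rewrite setTI.
Qed.

(** Forward: the sets whose preimage under [p] is measurable form a sigma-algebra containing the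
    open sets. Backward: test on [R^d] with its Borel sigma-algebra and [p] the identity. *)
Lemma borel_funP d (F : 'rV[R]_d -> R) : borel_fun F <-> rmeas F.
Proof.
split=> [bF disp S p mp|mF U oU].
  apply: (measurability _ (RGenOpens.measurableE R)).
  move=> _ [U [a [b ->]] <-]; rewrite setTI.
  have oU : open `]a, b[%classic by exact: interval_open.
  have := bF _ oU; apply: (@smallest_sub _ _ _ [set A | measurable (p @^-1` A)]).
    split => /=; first by rewrite preimage_set0.
    - by move=> A mA; rewrite setTD preimage_setC; exact: measurableC.
    - by move=> A mA; rewrite preimage_bigcup; exact: bigcupT_measurable.
  by move=> A oA; exact: open_coords_meas.
pose T := g_sigma_algebraType [set A : set 'rV[R]_d | open A].
have : measurable_fun [set: T] (fun v : T => F v).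
  apply: (mF _ T (fun v => v)) => i.
  apply: (measurability _ (RGenOpens.measurableE R)).
  move=> _ [V [a [b ->]] <-]; rewrite setTI.
  have oV : open `]a, b[%classic by exact: interval_open.
  apply: (@sub_sigma_algebra _ setT [set A : set 'rV[R]_d | open A]).
  have := @open_comp _ _ (fun v : 'rV[R]_d => v ord0 i) _ _ oV.
  by apply=> x _; exact: coord_continuous.
move=> /(_ measurableT U); rewrite setTI; apply.
exact: open_measurable.
Qed.

End BorelMeasurability.

(** * Iterated integrals *)

Section IteratedIntegral.
Context {R : realType}.
Local Notation mu := (@lebesgue_measure R).
Local Notation MR := (measurableTypeR R).

Definition cons_rv d (x : R) (v : 'rV[R]_d) : 'rV[R]_d.+1 :=
  row_mx (const_mx x : 'rV[R]_1) v.

Lemma cons_rv0 d x (v : 'rV[R]_d) : cons_rv x v ord0 ord0 = x.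
Proof.
rewrite /cons_rv mxE; case: split_ordP => j ij; first by rewrite mxE.
by move/(congr1 val): ij.
Qed.

Lemma cons_rvS d x (v : 'rV[R]_d) i : cons_rv x v ord0 (lift ord0 i) = v ord0 i.
Proof.
rewrite /cons_rv mxE; case: split_ordP => j ij.
  by move/(congr1 val): ij => /=; rewrite /bump /= add1n; case: j => -[].
by congr (v _ _); apply: val_inj; move/(congr1 val): ij => /= [].
Qed.

Lemma cons_rvB d a b (u v : 'rV[R]_d) :
  cons_rv a u - cons_rv b v = cons_rv (a - b) (u - v).
Proof.
have subE n (p q : 'rV[R]_n) i : (p - q) ord0 i = p ord0 i - q ord0 i.
  by rewrite !mxE.
apply/rowP => i; rewrite subE; case: (unliftP ord0 i) => [j ->|->].
  by rewrite !cons_rvS subE.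
by rewrite !cons_rv0.
Qed.

Lemma coords_meas_cons disp (S : measurableType disp) d (x : S -> R)
    (p : S -> 'rV[R]_d) :
  measurable_fun setT x -> coords_meas p ->
  coords_meas (fun s => cons_rv (x s) (p s)).
Proof.
move=> mx mp i; case: (unliftP ord0 i) => [j ->|->].
  by under eq_fun do rewrite cons_rvS; exact: mp.
by under eq_fun do rewrite cons_rv0; exact: mx.
Qed.

(** Tonelli gives measurability for the positive and the negative part separately. *)
Lemma measurable_integral_param disp disp' (S : measurableType disp)
    (T : measurableType disp') (m : {sigma_finite_measure set T -> \bar R})
    (G : S * T -> \bar R) :
  measurable_fun setT G ->
  measurable_fun setT (fun s => \int[m]_x G (s, x))%E.
Proof.
move=> mG.
have -> : (fun s => \int[m]_x G (s, x))%E =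
    (fun s => fubini_F m (G^\+) s - fubini_F m (G^\-) s)%E.
  apply/funext => s; rewrite integralE /fubini_F; congr (_ - _)%E;
    by apply: eq_integral => x _; rewrite ?funeposE ?funenegE.
by apply: emeasurable_funB; apply: measurable_fun_fubini_tonelli_F => //;
  [exact: measurable_funepos|exact: measurable_funeneg].
Qed.

(** The version of [rmeas] with a parameter: in the induction on [d], each outer integration
    variable becomes part of the parameter of the inner integral. *)
Definition pmeas disp (S : measurableType disp) d (F : S -> 'rV[R]_d -> R) :=
  forall disp' (S' : measurableType disp') (q : S' -> S) (p : S' -> 'rV[R]_d),
    measurable_fun setT q -> coords_meas p ->
    measurable_fun setT (fun s => F (q s) (p s)).

Lemma measurable_iint disp (S : measurableType disp) d
    (F : S -> 'rV[R]_d -> R) :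
  pmeas F -> measurable_fun setT (fun s => iint (fun v => (F s v)%:E)).
Proof.
elim: d disp S F => [|d IH] disp S F mF /=.
  apply/measurable_EFinP; apply: (mF _ S id (fun=> 0)).
    exact: measurable_id.
  by move=> i; exact: measurable_cst.
apply: (@measurable_integral_param _ _ S MR mu
  (fun z => iint (fun v => (F z.1 (cons_rv z.2 v))%:E))).
apply: (IH _ (S * MR)%type (fun z v => F z.1 (cons_rv z.2 v))).
move=> disp' S' q p mq mp.
apply: (mF _ S' (fun s => (q s).1) (fun s => cons_rv (q s).2 (p s))).
  exact: measurableT_comp measurable_fst mq.
by apply: coords_meas_cons => //; exact: measurableT_comp measurable_snd mq.
Qed.

Lemma rmeas_cons d (F : 'rV[R]_d.+1 -> R) x :
  rmeas F -> rmeas (fun v => F (cons_rv x v)).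
Proof.
move=> mF disp S p mp; apply: (mF _ _ (fun s => cons_rv x (p s))).
by apply: coords_meas_cons => //; exact: measurable_cst.
Qed.

Lemma measurable_iint_cons d (F : 'rV[R]_d.+1 -> R) :
  rmeas F ->
  measurable_fun setT (fun x : MR => iint (fun v => (F (cons_rv x v))%:E)).
Proof.
move=> mF; apply: (measurable_iint (F := fun (x : MR) v => F (cons_rv x v))).
move=> disp' S' q p mq mp; apply: (mF _ _ (fun s => cons_rv (q s) (p s))).
exact: coords_meas_cons.
Qed.

Lemma iint_cons d (h : 'rV[R]_d.+1 -> \bar R) :
  iint h = (\int[mu]_x iint (fun v => h (cons_rv x v)))%E.
Proof. by []. Qed.

Lemma iint_ge0 d (h : 'rV[R]_d -> \bar R) :
  (forall t, 0 <= h t)%E -> (0 <= iint h)%E.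
Proof.
elim: d h => [|d IH] h h0; first exact: h0.
by rewrite iint_cons; apply: integral_ge0 => x _; exact: IH.
Qed.

Lemma eq_iint d (h k : 'rV[R]_d -> \bar R) : h =1 k -> iint h = iint k.
Proof. by move=> /funext ->. Qed.

Lemma le_iint d (F G : 'rV[R]_d -> R) : rmeas F -> rmeas G ->
  (forall t, 0 <= F t) -> (forall t, F t <= G t) ->
  (iint (fun t => (F t)%:E) <= iint (fun t => (G t)%:E))%E.
Proof.
elim: d F G => [|d IH] F G mF mG F0 FG; first by rewrite lee_fin.
rewrite !iint_cons; apply: ge0_le_integral => //.
- by move=> x _; apply: iint_ge0 => v; rewrite lee_fin.
- exact: measurable_iint_cons.
- exact: measurable_iint_cons.
- by move=> x _; apply: IH => //; exact: rmeas_cons.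
Qed.

Lemma rmeas_comp1 d (k : R -> R) (F : 'rV[R]_d -> R) :
  measurable_fun setT k -> rmeas F -> rmeas (fun t => k (F t)).
Proof. by move=> mk mF disp S p mp; apply: measurableT_comp mk (mF _ _ _ mp). Qed.

Lemma rmeas_norm d (F : 'rV[R]_d -> R) : rmeas F -> rmeas (fun t => `|F t|).
Proof. by apply: rmeas_comp1; exact: normr_measurable. Qed.

Lemma rmeasD d (F G : 'rV[R]_d -> R) :
  rmeas F -> rmeas G -> rmeas (fun t => F t + G t).
Proof. by move=> mF mG disp S p mp; apply: measurable_funD; [exact: mF|exact: mG]. Qed.

Lemma rmeasM d (F G : 'rV[R]_d -> R) :
  rmeas F -> rmeas G -> rmeas (fun t => F t * G t).
Proof. by move=> mF mG disp S p mp; apply: measurable_funM; [exact: mF|exact: mG]. Qed.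

Lemma rmeas_cst d (c : R) : rmeas (fun _ : 'rV[R]_d => c).
Proof. by move=> disp S p mp; exact: measurable_cst. Qed.

Lemma abse_iint_le d (F : 'rV[R]_d -> R) : rmeas F ->
  (`|iint (fun t => (F t)%:E)| <= iint (fun t => `|F t|%:E))%E.
Proof.
elim: d F => [|d IH] F mF; first exact: lexx.
rewrite !iint_cons.
apply: le_trans (le_abse_integral _ _ _) _ => //; first exact: measurable_iint_cons.
apply: ge0_le_integral => //.
- exact: (measurableT_comp (@abse_measurable R setT) (measurable_iint_cons mF)).
- exact: (measurable_iint_cons (rmeas_norm mF)).
- by move=> x _; exact: (IH _ (rmeas_cons x mF)).
Qed.

(** Integrability on [R^d], phrased through the iterated integral of the absolute value. *)
Definition absint d (F : 'rV[R]_d -> R) :=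
  rmeas F /\ (iint (fun t => `|F t|%:E) < +oo)%E.

Lemma absint_fin_num d (F : 'rV[R]_d -> R) :
  absint F -> iint (fun t => (F t)%:E) \is a fin_num.
Proof.
by move=> [mF Foo]; rewrite fin_num_abs; apply: le_lt_trans (abse_iint_le mF) Foo.
Qed.

Lemma absint_integrable d (F : 'rV[R]_d.+1 -> R) : absint F ->
  mu.-integrable setT (fun x => iint (fun v => (F (cons_rv x v))%:E)).
Proof.
move=> [mF Foo]; apply/integrableP; split; first exact: measurable_iint_cons.
apply: le_lt_trans Foo; rewrite [leRHS]iint_cons; apply: ge0_le_integral => //.
- exact: (measurableT_comp (@abse_measurable R setT) (measurable_iint_cons mF)).
- exact: (measurable_iint_cons (rmeas_norm mF)).
- by move=> x _; exact: (abse_iint_le (rmeas_cons x mF)).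
Qed.

(** The inner integral of [|F|] is integrable in the first coordinate, hence finite almost
    everywhere. *)
Lemma absint_ae d (F : 'rV[R]_d.+1 -> R) : absint F ->
  {ae mu, forall x, absint (fun v => F (cons_rv x v))}.
Proof.
move=> [mF Foo].
have : absint (fun t => `|F t|).
  by split; [exact: rmeas_norm|under eq_fun do rewrite normr_id].
move=> /absint_integrable /(integrable_ae measurableT).
apply: filterS => x /(_ I) fx; split; first exact: rmeas_cons.
by rewrite ltey_eq fx.
Qed.

Lemma iint_lin d (a b : R) (F G : 'rV[R]_d -> R) : absint F -> absint G ->
  iint (fun t => (a * F t + b * G t)%:E) =
  (a%:E * iint (fun t => (F t)%:E) + b%:E * iint (fun t => (G t)%:E))%E.
Proof.
elim: d F G => [|d IH] F G iF iG; first by [].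
have mH : rmeas (fun t => a * F t + b * G t).
  by apply: rmeasD; apply: rmeasM;
    [exact: rmeas_cst|exact: iF.1|exact: rmeas_cst|exact: iG.1].
have IF := absint_integrable iF; have IG := absint_integrable iG.
rewrite !iint_cons -!integralZl// -integralD//; try exact: integrableZl.
(* The induction hypothesis applies only at those [x] where both slices are integrable, which is
   almost everywhere. *)
apply: ae_eq_integral => //.
- exact: (measurable_iint_cons mH).
- apply: emeasurable_funD; apply: measurable_funeM; apply: measurable_iint_cons;
    [exact: iF.1|exact: iG.1].
- have aeF := ae_filter_ringOfSetsType mu.
  by apply: filterS (filterI (absint_ae iF) (absint_ae iG)) => x [? ?] _; exact: IH.
Qed.

End IteratedIntegral.

(** * Reflection invariance and monotone convergence for iterated integrals *)

Section ReflectionAndMonotoneConvergence.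
Context {R : realType}.
Local Notation mu := (@lebesgue_measure R).
Local Notation MR := (measurableTypeR R).

Definition reflection (c : R) : MR -> MR := fun x => c - x.

Lemma measurable_refl (c : R) : measurable_fun setT (reflection c).
Proof.
have H : measurable_fun [set: R] (fun x : R => c - x).
  by apply: measurable_funB; [exact: measurable_cst|exact: measurable_id].
by move=> mT Y mY; exact: H.
Qed.

HB.instance Definition _ (c : R) :=
  isMeasurableFun.Build _ _ _ _ (reflection c) (measurable_refl c).

(** By uniqueness of Lebesgue measure it suffices that the pushforward gives half-open intervals
    their length; reflection only moves the closed end to the other side. *)
Lemma lebesgue_measure_refl (c : R) (A : set MR) : measurable A ->
  mu A = mu (reflection c @^-1` A).
Proof.
apply: (@lebesgue_measure_unique R (pushforward mu (reflection c))) => _ [[a b] _ <-] /=.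
rewrite /pushforward.
have -> : reflection c @^-1` `]a, b] = `[c - b, c - a[%classic.
  by apply/seteqP; split => x; rewrite /reflection /= !in_itv /= => /andP[? ?];
    apply/andP; split; lra.
rewrite !lebesgue_measure_itv /= !lte_fin ltrD2l ltrN2; case: ifP => // _.
by rewrite -!EFinB; congr (_%:E); ring.
Qed.

Lemma ge0_integral_refl (c : R) (G : MR -> \bar R) :
  measurable_fun setT G -> (forall x, 0 <= G x)%E ->
  (\int[mu]_x G (reflection c x) = \int[mu]_x G x)%E.
Proof.
move=> mG G0.
have := ge0_integral_pushforward (measurable_refl c) mu measurableT mG (fun x _ => G0 x).
rewrite preimage_setT /= => <-.
by apply: (@eq_measure_integral _ _ _ _ mu (pushforward mu (reflection c))) => A mA _;
  rewrite [RHS](lebesgue_measure_refl c).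
Qed.

Lemma integral_refl (c : R) (G : MR -> \bar R) :
  measurable_fun setT G ->
  (\int[mu]_x G (reflection c x) = \int[mu]_x G x)%E.
Proof.
move=> mG; rewrite integralE [RHS]integralE; congr (_ - _)%E.
- rewrite -[RHS](ge0_integral_refl c (measurable_funepos mG)); last by [].
  by apply: eq_integral => x _; rewrite !funeposE.
- rewrite -[RHS](ge0_integral_refl c (measurable_funeneg mG)); last by [].
  by apply: eq_integral => x _; rewrite !funenegE.
Qed.

Lemma iint_refl d (c : 'rV[R]_d) (F : 'rV[R]_d -> R) : rmeas F ->
  iint (fun t => (F (c - t))%:E) = iint (fun t => (F t)%:E).
Proof.
elim: d c F => [|d IH] c F mF.
  by rewrite /=; congr (F _)%:E; apply/rowP => -[].
pose c' : 'rV[R]_d := \row_j c ord0 (lift ord0 j).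
have -> : c = cons_rv (c ord0 ord0) c'.
  apply/rowP => i; case: (unliftP ord0 i) => [j ->|->].
    by rewrite cons_rvS mxE.
  by rewrite cons_rv0.
rewrite !iint_cons -(integral_refl (c ord0 ord0) (measurable_iint_cons mF)).
apply: eq_integral => x _.
under eq_iint do rewrite cons_rvB.
exact: (IH c' (fun v => F (cons_rv (c ord0 ord0 - x) v)) (rmeas_cons _ mF)).
Qed.

(** One-dimensional monotone convergence in the first coordinate; the induction hypothesis
    identifies the limit of the inner integrals. *)
Lemma iint_cvg_nondecreasing d (F : nat -> 'rV[R]_d -> R) (G : 'rV[R]_d -> R) :
  (forall n, rmeas (F n)) -> rmeas G -> (forall n t, 0 <= F n t) ->
  (forall t, {homo F ^~ t : n m / (n <= m)%N >-> n <= m}) ->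
  (forall t, F ^~ t @ \oo --> G t) ->
  iint (fun t => (F n t)%:E) @[n --> \oo] --> iint (fun t => (G t)%:E).
Proof.
elim: d F G => [|d IH] F G mF mG F0 ndF FG.
  by apply/fine_cvgP; split; [exact: nearW|exact: (FG 0)].
have Fx x : iint (fun v => (F n (cons_rv x v))%:E) @[n --> \oo] -->
    iint (fun v => (G (cons_rv x v))%:E).
  apply: (IH (fun n v => F n (cons_rv x v)) (fun v => G (cons_rv x v))) => //.
  - by move=> n; exact: rmeas_cons.
  - exact: rmeas_cons.
rewrite [X in _ --> X](_ : _ = (\int[mu]_x
   limn (fun n => iint (fun v => (F n (cons_rv x v))%:E)))%E); last first.
  rewrite iint_cons; apply: eq_integral => x _.
  exact/esym/(cvg_lim (@ereal_hausdorff R) (Fx x)).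
apply: (@cvg_monotone_convergence _ _ _ mu setT measurableT
  (fun n (x : MR) => iint (fun v => (F n (cons_rv x v))%:E))).
- by move=> n; exact: measurable_iint_cons.
- by move=> n x _; apply: iint_ge0 => v; rewrite lee_fin.
- move=> x _ n m nm; apply: (@le_iint _ _ (fun v => F n (cons_rv x v))
    (fun v => F m (cons_rv x v))) => //; try exact: rmeas_cons.
  by move=> t; exact: ndF.
Qed.

End ReflectionAndMonotoneConvergence.

(** * Square-integrable functions *)

Section SquareIntegrable.
Context {R : realType}.

Lemma absint_le d (F G : 'rV[R]_d -> R) : rmeas F -> absint G ->
  (forall t, `|F t| <= `|G t|) -> absint F.
Proof.
move=> mF [mG Goo] FG; split=> //; apply: le_lt_trans Goo.
by apply: le_iint => //; exact: rmeas_norm.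
Qed.

Lemma absint_lin d (a b : R) (F G : 'rV[R]_d -> R) : absint F -> absint G ->
  absint (fun t => a * F t + b * G t).
Proof.
move=> [mF Foo] [mG Goo].
have mS : rmeas (fun t => a * F t + b * G t).
  by apply: rmeasD; apply: rmeasM => //; exact: rmeas_cst.
have nF : absint (fun t => `|F t|).
  by split; [exact: rmeas_norm|under eq_iint do rewrite normr_id].
have nG : absint (fun t => `|G t|).
  by split; [exact: rmeas_norm|under eq_iint do rewrite normr_id].
split=> //.
apply: (@le_lt_trans _ _ (iint (fun t => (`|a| * `|F t| + `|b| * `|G t|)%:E))).
  apply: le_iint => //; first exact: rmeas_norm.
    by apply: rmeasD; apply: rmeasM; try exact: rmeas_cst; exact: rmeas_norm.
  by move=> t; rewrite -!normrM ler_normD.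
rewrite (iint_lin _ _ nF nG) -(fineK (absint_fin_num nF)).
by rewrite -(fineK (absint_fin_num nG)) -!EFinM -EFinD ltry.
Qed.

Lemma absintD d (F G : 'rV[R]_d -> R) : absint F -> absint G ->
  absint (fun t => F t + G t).
Proof.
move=> iF iG; have := absint_lin 1 1 iF iG.
by congr absint; apply/funext => t; rewrite !mul1r.
Qed.

(** The shape of the two components of [stft]; as [fine] sends infinite values to 0, it is the
    genuine integral for [absint] integrands. *)
Definition rint d (F : 'rV[R]_d -> R) : R := fine (iint (fun t => (F t)%:E)).

Lemma rintE d (F : 'rV[R]_d -> R) : absint F ->
  iint (fun t => (F t)%:E) = (rint F)%:E.
Proof. by move=> iF; rewrite fineK//; exact: absint_fin_num. Qed.

Lemma eq_rint d (F G : 'rV[R]_d -> R) : F =1 G -> rint F = rint G.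
Proof. by move=> /funext ->. Qed.

Lemma rint_lin d (a b : R) (F G : 'rV[R]_d -> R) : absint F -> absint G ->
  rint (fun t => a * F t + b * G t) = a * rint F + b * rint G.
Proof. by move=> iF iG; rewrite {1}/rint iint_lin // !rintE. Qed.

Lemma rint_refl d (c : 'rV[R]_d) (F : 'rV[R]_d -> R) : rmeas F ->
  rint (fun t => F (c - t)) = rint F.
Proof. by move=> mF; rewrite /rint iint_refl. Qed.

Lemma rint_ge0 d (F : 'rV[R]_d -> R) : (forall t, 0 <= F t) -> 0 <= rint F.
Proof. by move=> F0; apply/fine_ge0/iint_ge0 => t; rewrite lee_fin. Qed.

Lemma rint_le d (F G : 'rV[R]_d -> R) : absint F -> absint G ->
  (forall t, F t <= G t) -> rint F <= rint G.
Proof.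
move=> iF iG FG; rewrite -subr_ge0.
have -> : rint G - rint F = rint (fun t => 1 * G t + -1 * F t).
  by rewrite rint_lin// mul1r mulN1r.
by apply: rint_ge0 => t; rewrite mul1r mulN1r subr_ge0.
Qed.

(** [L2real] with [borel_fun] replaced by the equivalent [rmeas]. *)
Definition sqint d (F : 'rV[R]_d -> R) :=
  rmeas F /\ (iint (fun t => (F t ^+ 2)%:E) < +oo)%E.

Lemma sqint_absint d (F : 'rV[R]_d -> R) : sqint F ->
  absint (fun t => F t ^+ 2).
Proof.
move=> [mF Foo]; split; last by under eq_iint do rewrite ger0_norm ?sqr_ge0//.
by have := rmeasM mF mF; congr rmeas; apply/funext => t; rewrite expr2.
Qed.

(** Domination by [|F G| <= F^2 + G^2]. *)
Lemma absintM d (F G : 'rV[R]_d -> R) : sqint F -> sqint G ->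
  absint (fun t => F t * G t).
Proof.
move=> iF iG; apply: (absint_le _ (absintD (sqint_absint iF) (sqint_absint iG))).
  exact: rmeasM iF.1 iG.1.
move=> t; rewrite (ger0_norm (addr_ge0 (sqr_ge0 _) (sqr_ge0 _))) ler_norml.
have := sqr_ge0 (F t + G t); have := sqr_ge0 (F t - G t).
have := sqr_ge0 (F t); have := sqr_ge0 (G t).
by move=> *; apply/andP; split; nra.
Qed.

Lemma absint_sqint d (F : 'rV[R]_d -> R) : rmeas F ->
  absint (fun t => F t ^+ 2) -> sqint F.
Proof.
move=> mF [_ Foo]; split=> //; move: Foo.
by under eq_iint do rewrite ger0_norm ?sqr_ge0//.
Qed.

Lemma sqintMb d (F u : 'rV[R]_d -> R) : sqint F -> rmeas u ->
  (forall t, `|u t| <= 1) -> sqint (fun t => F t * u t).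
Proof.
move=> iF mu u1; have mFu := rmeasM iF.1 mu; apply: absint_sqint => //.
apply: (absint_le _ (sqint_absint iF)).
  by have := rmeasM mFu mFu; congr rmeas; apply/funext => t; rewrite expr2.
by move=> t; rewrite exprMn normrM ler_piMr// normrX exprn_ile1.
Qed.

Lemma rmeas_refl d (c : 'rV[R]_d) (F : 'rV[R]_d -> R) : rmeas F ->
  rmeas (fun t => F (c - t)).
Proof.
move=> mF disp S p mp; apply: (mF _ _ (fun s => c - p s)) => i.
under eq_fun do rewrite !mxE.
by apply: measurable_funB; [exact: measurable_cst|exact: mp].
Qed.

Lemma sqint_refl d (c : 'rV[R]_d) (F : 'rV[R]_d -> R) : sqint F ->
  sqint (fun t => F (c - t)).
Proof.
move=> iF; split; first exact: rmeas_refl iF.1.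
by rewrite (iint_refl c (sqint_absint iF).1); exact: iF.2.
Qed.

(** A translation is the composite of the reflections [t |-> 0 - t] and [t |-> c - t]. *)
Lemma sqint_transl d (c : 'rV[R]_d) (F : 'rV[R]_d -> R) : sqint F ->
  sqint (fun t => F (t - c)).
Proof.
move=> iF; have := sqint_refl c (sqint_refl 0 iF).
by congr sqint; apply/funext => t; rewrite sub0r opprB.
Qed.

Lemma rmeas_dotv d (w : 'rV[R]_d) : rmeas (dotv w).
Proof.
move=> disp S p mp; apply: measurable_sum => i.
by apply: measurable_funM; [exact: measurable_cst|exact: mp].
Qed.

End SquareIntegrable.

(** * The pair of signals *)

Section ConjugatePair.
Context {R : realType}.

Lemma cosD2pi_int (m : int) (x : R) : cos (x + 2 * pi * m%:~R) = cos x.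
Proof.
have e (n : nat) (y : R) : y + 2 * pi * n%:R = y + (pi *+ 2) *+ n.
  by rewrite -mulr_natr -(mulr_natr (pi *+ 2)); congr (_ + _); ring.
case: m => n; first by rewrite -pmulrn e (periodicn (@cosD2pi R)).
rewrite NegzE mulrNz -pmulrn mulrN.
by rewrite -[in RHS](subrK (2 * pi * n.+1%:R) x) e (periodicn (@cosD2pi R)).
Qed.

Lemma sinD2pi_int (m : int) (x : R) : sin (x + 2 * pi * m%:~R) = sin x.
Proof.
have e (n : nat) (y : R) : y + 2 * pi * n%:R = y + (pi *+ 2) *+ n.
  by rewrite -mulr_natr -(mulr_natr (pi *+ 2)); congr (_ + _); ring.
case: m => n; first by rewrite -pmulrn e (periodicn (@sinD2pi R)).
rewrite NegzE mulrNz -pmulrn mulrN.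
by rewrite -[in RHS](subrK (2 * pi * n.+1%:R) x) e (periodicn (@sinD2pi R)).
Qed.

Lemma norm_complexE (z : R[i]) : `|z| = (Num.sqrt (sqmod z))%:C.
Proof. by case: z. Qed.

Lemma dotvD d (w s t : 'rV[R]_d) : dotv w (s + t) = dotv w s + dotv w t.
Proof.
by rewrite /dotv -big_split; apply: eq_bigr => i _; rewrite mxE mulrDr.
Qed.

Lemma dotvN d (w t : 'rV[R]_d) : dotv w (- t) = - dotv w t.
Proof. by rewrite /dotv -sumrN; apply: eq_bigr => i _; rewrite mxE mulrN. Qed.

Definition phase d (w t : 'rV[R]_d) : R := 2 * pi * dotv w t.

Lemma rmeas_cos_phase d (w : 'rV[R]_d) : rmeas (fun t => cos (phase w t)).
Proof.
apply: (rmeas_comp1 (k := cos)).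
  by apply: continuous_measurable_fun; exact: continuous_cos.
by apply: rmeasM; [exact: rmeas_cst|exact: rmeas_dotv].
Qed.

Lemma rmeas_sin_phase d (w : 'rV[R]_d) : rmeas (fun t => sin (phase w t)).
Proof.
apply: (rmeas_comp1 (k := sin)).
  by apply: continuous_measurable_fun; exact: continuous_sin.
by apply: rmeasM; [exact: rmeas_cst|exact: rmeas_dotv].
Qed.

Context (d : nat) (g : 'rV[R]_d -> R) (ig : sqint g).
Implicit Types x w a b c l t : 'rV[R]_d.

(** [kcos - i ksin] is the STFT at [(x, w)] of the reflected window [g (c - t)]. *)
Definition kcos (x w c : 'rV[R]_d) : R :=
  rint (fun t => g (t - x) * (g (c - t) * cos (phase w t))).
Definition ksin (x w c : 'rV[R]_d) : R :=
  rint (fun t => g (t - x) * (g (c - t) * sin (phase w t))).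

Lemma norm_cos_le1 (y : R) : `|cos y| <= 1.
Proof. by rewrite ler_norml cos_geN1 cos_le1. Qed.

Lemma norm_sin_le1 (y : R) : `|sin y| <= 1.
Proof. by rewrite ler_norml sin_geN1 sin_le1. Qed.

Lemma absint_kcos x w c :
  absint (fun t => g (t - x) * (g (c - t) * cos (phase w t))).
Proof.
apply: absintM; first exact: sqint_transl.
apply: sqintMb; [exact: sqint_refl|exact: rmeas_cos_phase|].
by move=> t; exact: norm_cos_le1.
Qed.

Lemma absint_ksin x w c :
  absint (fun t => g (t - x) * (g (c - t) * sin (phase w t))).
Proof.
apply: absintM; first exact: sqint_transl.
apply: sqintMb; [exact: sqint_refl|exact: rmeas_sin_phase|].
by move=> t; exact: norm_sin_le1.
Qed.

(* [t |-> x + c - t] swaps the two factors [g (t - x)] and [g (c - t)]. *)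
Lemma phase_swap x w c t (m : int) : dotv w c = m%:~R ->
  phase w (x + c - t) = phase w x - phase w t + 2 * pi * m%:~R.
Proof. by move=> wc; rewrite /phase !dotvD dotvN wc; ring. Qed.

(** Substitute [t |-> x + c - t] and expand the cosine of a difference. Together with [ksin_swap]:
    the vector [(kcos, ksin)] is fixed by the matrix with rows [(cos, sin)] and [(sin, - cos)] at
    [phase w x]. *)
Lemma kcos_swap x w c (m : int) : dotv w c = m%:~R ->
  kcos x w c = cos (phase w x) * kcos x w c + sin (phase w x) * ksin x w c.
Proof.
move=> wc; rewrite -(rint_lin _ _ (absint_kcos x w c) (absint_ksin x w c)).
rewrite {1}/kcos -(rint_refl (x + c) (absint_kcos x w c).1).
apply: eq_rint => t; rewrite (phase_swap _ _ wc) cosD2pi_int cosB.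
have -> : x + c - t - x = c - t by rewrite addrAC (addrC x) addrK.
have -> : c - (x + c - t) = t - x by rewrite opprB addrCA opprD [c + _]addrC subrK.
by ring.
Qed.

Lemma ksin_swap x w c (m : int) : dotv w c = m%:~R ->
  ksin x w c = sin (phase w x) * kcos x w c + - cos (phase w x) * ksin x w c.
Proof.
move=> wc; rewrite -(rint_lin _ _ (absint_kcos x w c) (absint_ksin x w c)).
rewrite {1}/ksin -(rint_refl (x + c) (absint_ksin x w c).1).
apply: eq_rint => t; rewrite (phase_swap _ _ wc) sinD2pi_int sinB.
have -> : x + c - t - x = c - t by rewrite addrAC (addrC x) addrK.
have -> : c - (x + c - t) = t - x by rewrite opprB addrCA opprD [c + _]addrC subrK.
by ring.
Qed.

(* Both pairs lie in the line fixed by the reflection matrix of [phase w x]. *)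
Lemma kcos_ksin_proportional x w a b (m n : int) :
  dotv w a = m%:~R -> dotv w b = n%:~R ->
  kcos x w a * ksin x w b = kcos x w b * ksin x w a.
Proof.
move=> wa wb; have := kcos_swap x wa; have := ksin_swap x wa.
have := kcos_swap x wb; have := ksin_swap x wb.
move: (kcos x w a) (ksin x w a) (kcos x w b) (ksin x w b).
move: (cos _) (sin _) => c s P Q P1 Q1 e1 e2 e3 e4.
(* With [X = P * Q1] and [Y = P1 * Q], these products yield [X - Y = - c * (X - Y)] and
   [X - Y = c * (X - Y)], so [X = Y]. *)
have := congr1 ( *%R P) e1; have := congr1 ( *%R Q) e2.
by have := congr1 ( *%R P1) e3; have := congr1 ( *%R Q1) e4; lra.
Qed.

(** [eps = 1] and [eps = -1] give the two conjugate signals. Writing [0 - t] puts both components in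
    the form [h (c - t)]. *)
Definition conj_pair (h : 'rV[R]_d -> R) (eps : R) (l t : 'rV[R]_d) : R[i] :=
  h (0 - t) +i* (eps * h (l - t)).

Lemma stft_conj_pair eps l x w :
  stft g (conj_pair g eps l) x w =
  (kcos x w 0 + eps * ksin x w l) +i* (eps * kcos x w l - ksin x w 0).
Proof.
rewrite /stft /=; congr (_ +i* _).
- transitivity (rint (fun t =>
    1 * (g (t - x) * (g (0 - t) * cos (phase w t)))
    + eps * (g (t - x) * (g (l - t) * sin (phase w t))))).
    by apply: eq_rint => t; rewrite /phase; ring.
  by rewrite (rint_lin _ _ (absint_kcos x w 0) (absint_ksin x w l)) mul1r.
- transitivity (rint (fun t =>
    eps * (g (t - x) * (g (l - t) * cos (phase w t)))
    + -1 * (g (t - x) * (g (0 - t) * sin (phase w t))))).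
    by apply: eq_rint => t; rewrite /phase; ring.
  by rewrite (rint_lin _ _ (absint_kcos x w l) (absint_ksin x w 0)) mulN1r.
Qed.

Lemma norm_stft_conj_pair l x w (m : int) : dotv w l = m%:~R ->
  `|stft g (conj_pair g 1 l) x w| = `|stft g (conj_pair g (-1) l) x w|.
Proof.
move=> wl; have w0 : dotv w (0 : 'rV[R]_d) = 0%:~R.
  by rewrite /dotv big1 // => i _; rewrite mxE mulr0.
rewrite !norm_complexE !stft_conj_pair /sqmod /=.
(* The squared moduli differ by [4 * (kcos x w 0 * ksin x w l - kcos x w l * ksin x w 0)]. *)
have := kcos_ksin_proportional x w0 wl.
by move=> e; congr (Num.sqrt _)%:C; nra.
Qed.

End ConjugatePair.

(** * Decorrelation of distant translates *)

Section Correlation.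
Context {R : realType}.

Lemma sqintD d (F G : 'rV[R]_d -> R) : sqint F -> sqint G ->
  sqint (fun t => F t + G t).
Proof.
move=> iF iG; apply: absint_sqint; first exact: rmeasD iF.1 iG.1.
have := absintD (absint_lin 1 2 (sqint_absint iF) (absintM iF iG)) (sqint_absint iG).
by congr absint; apply/funext => t; ring.
Qed.

Lemma sqintZ d (a : R) (F : 'rV[R]_d -> R) : sqint F ->
  sqint (fun t => a * F t).
Proof.
move=> iF; apply: absint_sqint; first exact: rmeasM (rmeas_cst _) iF.1.
have := absint_lin (a ^+ 2) 0 (sqint_absint iF) (sqint_absint iF).
by congr absint; apply/funext => t; ring.
Qed.

Lemma rint_transl d (c : 'rV[R]_d) (F : 'rV[R]_d -> R) : rmeas F ->
  rint (fun t => F (t - c)) = rint F.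
Proof.
move=> mF; rewrite -(rint_refl 0 mF) -(rint_refl c (rmeas_refl 0 mF)).
by apply: eq_rint => t; rewrite sub0r opprB.
Qed.

(** The degenerate case of Cauchy-Schwarz: the integral of [(G - s F)^2] is then affine in [s] with
    slope [- 2 C], and nonnegative for every [s], so [C = 0]. *)
Lemma rint_mul_eq0 d (F G : 'rV[R]_d -> R) : sqint F -> sqint G ->
  rint (fun t => F t ^+ 2) = 0 -> rint (fun t => F t * G t) = 0.
Proof.
move=> iF iG F0; set C := rint _.
have key (s : R) : 0 <= rint (fun t => G t ^+ 2) - 2 * s * C.
  rewrite [leRHS](_ : _ = rint (fun t => (G t - s * F t) ^+ 2)).
    by apply: rint_ge0 => t; exact: sqr_ge0.
  have iFG := absintM iF iG.
  transitivity (rint (fun t => 1 * (1 * G t ^+ 2 + (- (2 * s)) * (F t * G t))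
                               + s ^+ 2 * F t ^+ 2)).
    rewrite rint_lin ?rint_lin//; try exact: sqint_absint.
      by rewrite F0 /C; ring.
    by apply: absint_lin => //; exact: sqint_absint.
  by apply: eq_rint => t; ring.
apply/eqP/negPn/negP => C0.
(* At this [s] the affine function takes the value [-1]. *)
have := key ((rint (fun t => G t ^+ 2) + 1) / (2 * C)).
have -> : 2 * ((rint (fun t => G t ^+ 2) + 1) / (2 * C)) * C =
  rint (fun t => G t ^+ 2) + 1 by field.
by lra.
Qed.

(** Bounding one coordinate is enough: a shift by more than [2 n] in that coordinate makes the slab
    disjoint from its translate. *)
Definition slab d (i : 'I_d) (n : nat) (t : 'rV[R]_d) : R :=
  (`|t ord0 i| <= n%:R)%R%:R.

Lemma slab_ge0 d (i : 'I_d) n t : 0 <= slab i n t.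
Proof. exact: ler0n. Qed.

Lemma slab_le1 d (i : 'I_d) n t : slab i n t <= 1.
Proof. by rewrite lern1 leq_b1. Qed.

Lemma rmeas_slab d (i : 'I_d) n : rmeas (slab i n).
Proof.
move=> disp S p mp.
have m1 : measurable_fun setT (fun s => `|p s ord0 i|).
  exact: (measurableT_comp (@normr_measurable R setT) (mp i)).
pose k (x : R) : R := \1_(`]-oo, n%:R]%classic) x.
have mk : measurable_fun setT k.
  by apply: measurable_indic; exact: measurable_itv.
have := measurableT_comp mk m1; congr measurable_fun.
by apply/funext => s; rewrite /= /k indicE mem_setE in_itv.
Qed.

Lemma absint_slab d (i : 'I_d) n (h : 'rV[R]_d -> R) : absint h ->
  absint (fun t => h t * slab i n t).
Proof.
move=> ih; apply: (absint_le _ ih); first exact: rmeasM ih.1 (rmeas_slab _ _).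
by move=> t; rewrite normrM ler_piMr// ger0_norm ?slab_ge0// slab_le1.
Qed.

Lemma slab_exhausts d (i : 'I_d) (h : 'rV[R]_d -> R) (e : R) :
  absint h -> (forall t, 0 <= h t) -> 0 < e ->
  exists n, rint h - rint (fun t => h t * slab i n t) < e.
Proof.
move=> ih h0 e0.
have c : iint (fun t => (h t * slab i n t)%:E) @[n --> \oo] -->
    iint (fun t => (h t)%:E).
  apply: iint_cvg_nondecreasing.
  - by move=> n; exact: rmeasM ih.1 (rmeas_slab _ _).
  - exact: ih.1.
  - by move=> n t; apply: mulr_ge0 => //; exact: slab_ge0.
  - move=> t n m nm; apply: ler_wpM2l => //; rewrite /slab ler_nat.
    case: (leP _ n%:R) => // tn; rewrite (le_trans tn)// ler_nat//.
  (* Each [t] lies in all slabs from some index on, so the sequence is eventually constant. *)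
  - move=> t; apply: cvg_near_cst.
    exists (Num.truncn `|t ord0 i|).+1 => // n /= tn.
    rewrite /slab (_ : _ <= _) ?mulr1//.
    by apply/ltW/(lt_le_trans (truncnS_gt _)); rewrite ler_nat.
have cr : rint (fun t => h t * slab i n t) @[n --> \oo] --> rint h.
  by move: c; rewrite (rintE ih) => /fine_cvgP[].
have /cvgrPdist_lt /(_ _ e0) [n _ /(_ n (leqnn _))] := cr.
by move=> hn; exists n; exact: le_lt_trans (ler_norm _) hn.
Qed.

(* Split at the slab: off it [h (0 - t)] is small, on it [h (l - t)] is. *)
Lemma correlation_lt d (i : 'I_d) n (h : 'rV[R]_d -> R) (l : 'rV[R]_d) :
  sqint h -> 2 * n%:R < `|l ord0 i| ->
  rint (fun t => h t ^+ 2) - rint (fun t => h t ^+ 2 * slab i n t)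
    < rint (fun t => h t ^+ 2) / 8 ->
  `|rint (fun t => h (0 - t) * h (l - t))| < rint (fun t => h t ^+ 2).
Proof.
move=> ih ln; set M := rint (fun t => h t ^+ 2) => tail.
have iA := sqint_absint ih.
(* [k] is the part of [h^2] carried outside the slab; its integral is the tail. *)
pose k t := 1 * h t ^+ 2 + -1 * (h t ^+ 2 * slab i n t).
have ik : absint k by apply: absint_lin => //; exact: absint_slab.
have kE : rint k < M / 8.
  by rewrite rint_lin//; [rewrite -/M; lra|exact: absint_slab].
have k0 t : 0 <= k t.
  by rewrite /k mul1r mulN1r subr_ge0 ler_piMr ?sqr_ge0 ?slab_le1.
have iA' c : absint (fun t => h (c - t) ^+ 2).
  exact: sqint_absint (sqint_refl c ih).
have ik' c : absint (fun t => k (c - t)).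
  split; first exact: rmeas_refl ik.1.
  by rewrite (iint_refl c (rmeas_norm ik.1)); exact: ik.2.
have iH := absintM (sqint_refl 0 ih) (sqint_refl l ih).
(* From [|a b| <= a^2 / 4 + b^2], where the factor with weight 1 is the one off the slab, so that
   its square is bounded by [k]. The sum is symmetric to cover both cases. *)
pose B t := 1 * (1 / 4 * h (0 - t) ^+ 2 + 1 / 4 * h (l - t) ^+ 2)
            + 1 * (1 * k (0 - t) + 1 * k (l - t)).
have iB1 := absint_lin (1 / 4) (1 / 4) (iA' 0) (iA' l).
have iB2 := absint_lin 1 1 (ik' 0) (ik' l).
have iB : absint B by exact: absint_lin.
have BE : rint B = M / 2 + 2 * rint k.
  rewrite /B rint_lin// rint_lin// rint_lin// !(rint_refl _ ik.1).
  by rewrite !(rint_refl _ iA.1) -/M; lra.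
have bnd t : `|h (0 - t) * h (l - t)| <= B t.
  (* The points [0 - t] and [l - t] differ by more than [2 n] in coordinate [i], so they cannot both
     lie in the slab. *)
  have k1 : h (0 - t) ^+ 2 <= k (0 - t) \/ h (l - t) ^+ 2 <= k (l - t).
    rewrite /k /slab; case: (leP `|(0 - t) ord0 i|) => h1; last by left; rewrite /= mulr0; lra.
    case: (leP `|(l - t) ord0 i|) => h2; last by right; rewrite /= mulr0; lra.
    have := ler_normB ((l - t) ord0 i) ((0 - t) ord0 i).
    rewrite !mxE.
    have -> : l ord0 i - t ord0 i - (0 - t ord0 i) = l ord0 i by ring.
    by move: h1 h2; rewrite !mxE; lra.
  rewrite /B ler_norml; have := k0 (0 - t); have := k0 (l - t).
  move: k1; move: (h (0 - t)) (h (l - t)) (k (0 - t)) (k (l - t)).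
  move=> a b p q k1 q0 p0.
  have s1 := sqr_ge0 (a / 2 - b); have s2 := sqr_ge0 (a / 2 + b).
  have s3 := sqr_ge0 (a - b / 2); have s4 := sqr_ge0 (a + b / 2).
  by case: k1 => k1; apply/andP; split; nra.
(* Since [0 <= rint k < M / 8], [M] is positive and [M / 2 + 2 * rint k < 3 * M / 4 < M]. *)
have lt1 : rint B < M by rewrite BE; have := rint_ge0 k0; lra.
rewrite ltr_norml; apply/andP; split; last first.
  apply: le_lt_trans lt1; apply: rint_le => // t.
  exact: le_trans (ler_norm _) (bnd t).
rewrite ltrNl; apply: le_lt_trans lt1.
have -> : - rint (fun t => h (0 - t) * h (l - t)) =
    rint (fun t => -1 * (h (0 - t) * h (l - t)) + 0 * (h (0 - t) * h (l - t))).
  by rewrite rint_lin// mul0r addr0 mulN1r.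
apply: rint_le => //; first exact: absint_lin.
move=> t; rewrite mul0r addr0 mulN1r.
by apply: le_trans (bnd t); rewrite -normrN ler_norm.
Qed.

End Correlation.

(** * The unit cube as a square-integrable function of norm one *)

Section UnitCube.
Context {R : realType}.
Local Notation mu := (@lebesgue_measure R).

Definition cube d (t : 'rV[R]_d) : R :=
  \prod_(i < d) \1_(`[0, 1]%classic) (t ord0 i).

Lemma measurable_unit_indic : measurable_fun setT (\1_(`[0, 1]%classic) : R -> R).
Proof. by apply: measurable_indic; exact: measurable_itv. Qed.

Lemma rmeas_cube d : rmeas (@cube d).
Proof.
move=> disp S p mp; apply: measurable_prod => i _.
exact: measurableT_comp measurable_unit_indic (mp i).
Qed.

Lemma cube_cons d x (v : 'rV[R]_d) :
  cube (cons_rv x v) = \1_(`[0, 1]%classic) x * cube v.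
Proof.
rewrite /cube big_ord_recl cons_rv0; congr (_ * _).
by apply: eq_bigr => i _; rewrite cons_rvS.
Qed.

(** The factor [c] is there for the induction: it absorbs the indicator of the outer coordinate,
    which equals its own square. *)
Lemma iint_cube d (c : R) : iint (fun t : 'rV[R]_d => (c * cube t ^+ 2)%:E) = c%:E.
Proof.
elim: d c => [|d IH] c; first by rewrite /= /cube big_ord0 expr1n mulr1.
rewrite iint_cons.
transitivity (\int[mu]_x (c%:E * (\1_(`[0, 1]%classic) x)%:E))%E.
  apply: eq_integral => x _.
  transitivity (iint (fun v : 'rV[R]_d =>
      (c * \1_(`[0, 1]%classic) x * cube v ^+ 2)%:E)).
    apply: eq_iint => v; rewrite cube_cons indicE; case: (_ \in _) => /=;
      by congr (_%:E); ring.
  by rewrite IH EFinM.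
have mI : measurable (`[0, 1]%classic : set (measurableTypeR R)).
  exact: measurable_itv.
have i1 : (\int[mu]_x (\1_(`[0, 1]%classic) x)%:E = 1)%E.
  rewrite integral_indic// setIT; transitivity (mu `[0, 1]%classic) => //.
  by rewrite lebesgue_measure_itv /= lte_fin ltr01 oppr0 adde0.
rewrite integralZl//; last first.
  apply/integrableP; split.
    by apply/measurable_EFinP; exact: measurable_unit_indic.
  under eq_integral do rewrite gee0_abs ?lee_fin//.
  by rewrite i1 ltry.
by rewrite i1 mule1.
Qed.

Lemma sqint_cube d : sqint (@cube d).
Proof.
split; first exact: rmeas_cube.
under eq_iint do rewrite -[_ ^+ 2]mul1r.
by rewrite iint_cube ltry.
Qed.

Lemma rint_cube d : rint (fun t : 'rV[R]_d => cube t ^+ 2) = 1.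
Proof.
rewrite /rint; under eq_iint do rewrite -[_ ^+ 2]mul1r.
by rewrite iint_cube.
Qed.

End UnitCube.

(** * Long dual lattice vectors, and membership and non-proportionality of the pair *)

Section Construction.
Context {R : realType}.

(** Take column [i] of the inverse of [B]: pairing it with [l B] leaves [l e_i]. *)
Lemma dual_vector d (B : 'M[R]_d) (i : 'I_d) : B \in unitmx ->
  exists v : 'rV[R]_d, forall l, dotv (latpt B l) v = (l ord0 i)%:~R.
Proof.
move=> uB; exists ((invmx B *m (delta_mx i ord0 : 'cV[R]_d))^T) => l.
transitivity ((latpt B l *m (invmx B *m (delta_mx i ord0 : 'cV[R]_d))) ord0 ord0).
  by rewrite [RHS]mxE /dotv; apply: eq_bigr => j _; rewrite [X in _ * X]mxE.
rewrite /latpt -mulmxA (mulmxA B) mulmxV// mul1mx mxE (bigD1 i)//= big1.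
  by rewrite !mxE !eqxx mulr1 addr0.
by move=> j ji; rewrite !mxE (negbTE ji) mulr0.
Qed.

(** Large integer multiples of one nonzero dual vector. The coordinate [i] comes before [r] because
    the slab in direction [i] is chosen first and its width then dictates [r]. *)
Lemma long_dual_vector d (B : 'M[R]_d) : (0 < d)%N -> B \in unitmx ->
  exists i : 'I_d, forall r : R, exists2 v : 'rV[R]_d, r < `|v ord0 i| &
    forall l, exists m : int, dotv (latpt B l) v = m%:~R.
Proof.
move=> d0 uB; have [v vl] := dual_vector (Ordinal d0) uB.
(* The dual vector is nonzero, as it pairs to 1 with the lattice point of the all-ones index. *)
have [i vi] : exists i, v ord0 i != 0.
  apply/existsP; rewrite -negb_forall; apply/negP => /forallP v0.
  have := vl (\row_j 1); rewrite /dotv big1; last first.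
    by move=> i _; rewrite (eqP (v0 i)) mulr0.
  by rewrite mxE => /eqP; rewrite eq_sym oner_eq0.
exists i => r; have vi0 : 0 < `|v ord0 i| by rewrite normr_gt0.
pose N := (Num.truncn (r / `|v ord0 i|)).+1.
exists (N%:R *: v).
  by rewrite mxE normrM normr_nat -ltr_pdivrMr// truncnS_gt.
move=> l; exists (N%:Z * l ord0 (Ordinal d0)).
rewrite intrM -vl -pmulrn /dotv mulr_sumr; apply: eq_bigr => j _.
by rewrite [X in _ * X]mxE mulrCA.
Qed.

Lemma sqmod_conj_pair d (h : 'rV[R]_d -> R) eps l t : `|eps| = 1 ->
  sqmod (conj_pair h eps l t) = h (0 - t) ^+ 2 + h (l - t) ^+ 2.
Proof.
move=> e1; rewrite /sqmod /= exprMn -(real_normK (num_real eps)) e1.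
by rewrite expr1n mul1r.
Qed.

Lemma L2_conj_pair d (h : 'rV[R]_d -> R) eps l : sqint h -> `|eps| = 1 ->
  L2 (conj_pair h eps l).
Proof.
move=> ih e1; split.
- by apply/borel_funP; exact: (sqint_refl 0 ih).1.
- by apply/borel_funP; exact: (sqintZ eps (sqint_refl l ih)).1.
- under eq_iint do rewrite sqmod_conj_pair//.
  have := absintD (sqint_absint (sqint_refl 0 ih)) (sqint_absint (sqint_refl l ih)).
  by move/rintE => ->; rewrite ltry.
Qed.

(** Each component integrates the translated null window against a square-integrable function, so
    [rint_mul_eq0] applies. *)
Lemma stft_eq0 d (g : 'rV[R]_d -> R) (f : 'rV[R]_d -> R[i]) x w :
  sqint g -> rint (fun t => g t ^+ 2) = 0 ->
  sqint (fun t => complex.Re (f t)) -> sqint (fun t => complex.Im (f t)) ->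
  stft g f x w = 0.
Proof.
move=> ig g0 iRe iIm.
have gx0 : rint (fun t => g (t - x) ^+ 2) = 0.
  by rewrite (rint_transl x (sqint_absint ig).1).
have cosb t := norm_cos_le1 (phase w t).
have sinb t := norm_sin_le1 (phase w t).
have iC F : sqint F -> sqint (fun t => F t * cos (phase w t)).
  by move=> iF; apply: sqintMb => //; exact: rmeas_cos_phase.
have iS F : sqint F -> sqint (fun t => F t * sin (phase w t)).
  by move=> iF; apply: sqintMb => //; exact: rmeas_sin_phase.
rewrite /stft /=.
rewrite [X in X +i* _](rint_mul_eq0 (sqint_transl x ig)
  (sqintD (iC _ iRe) (iS _ iIm)) gx0).
have := rint_mul_eq0 (sqint_transl x ig)
  (sqintD (iC _ iIm) (sqintZ (-1) (iS _ iRe))) gx0.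
rewrite /rint; under eq_iint do rewrite mulN1r.
by move=> ->.
Qed.

(** For [nu = a + i b] the integral equals [2 (1 - a) M + 2 (1 + a) M - 4 b C = 4 (M - b C)], which
    is positive since [|b| <= 1] and [|C| < M]. *)
Lemma conj_pair_not_proportional d (h : 'rV[R]_d -> R) (l : 'rV[R]_d) (nu : R[i]) :
  sqint h -> `|nu| = 1 ->
  `|rint (fun t => h (0 - t) * h (l - t))| < rint (fun t => h t ^+ 2) ->
  iint (fun t => (sqmod (conj_pair h 1 l t - nu * conj_pair h (-1) l t))%:E) <> 0%E.
Proof.
case: nu => a b ih; rewrite norm_complexE => -[/(congr1 (fun x => x ^+ 2))].
rewrite sqr_sqrtr ?addr_ge0 ?sqr_ge0// expr1n /sqmod /= => ab.
set C := rint _; set M := rint _ => CM.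
have iP := sqint_absint (sqint_refl 0 ih); have iQ := sqint_absint (sqint_refl l ih).
have iPQ := absintM (sqint_refl 0 ih) (sqint_refl l ih).
pose K t := 1 * (2 * (1 - a) * h (0 - t) ^+ 2 + 2 * (1 + a) * h (l - t) ^+ 2)
  + (- (4 * b)) * (h (0 - t) * h (l - t)).
have iPQ2 := absint_lin (2 * (1 - a)) (2 * (1 + a)) iP iQ.
have iK : absint K by exact: absint_lin.
rewrite (eq_iint (k := fun t => (K t)%:E)); last first.
  move=> t; congr (_%:E); rewrite /K /=.
  move: (h (0 - t)) (h (l - t)) => p q; apply/eqP; rewrite -subr_eq0.
  rewrite (_ : _ - _ = (a ^+ 2 + b ^+ 2 - 1) * (p ^+ 2 + q ^+ 2)); last by ring.
  by rewrite ab subrr mul0r.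
rewrite rintE// => -[].
rewrite /K rint_lin// rint_lin// !(rint_refl _ (sqint_absint ih).1) -/M -/C.
have b1 : `|b| <= 1.
  by rewrite -(@expr_le1 _ 2)// real_normK ?num_real//; have := sqr_ge0 a; lra.
have bC : b * C <= `|C|.
  by apply: le_trans (ler_norm _) _; rewrite normrM ler_piMl.
by lra.
Qed.

End Construction.

Theorem theorem1p4 (R : realType) (d : nat) (g : 'rV[R]_d -> R)
    (A B : 'M[R]_d) :
  (0 < d)%N -> L2real g -> A \in unitmx -> B \in unitmx ->
  exists f1 f2 : 'rV[R]_d -> R[i],
    [/\ L2 f1, L2 f2,
        (forall (k l : 'rV[int]_d),
            `|stft g f1 (latpt A k) (latpt B l)| =
            `|stft g f2 (latpt A k) (latpt B l)|),
        (forall t : 'rV[R]_d, `|f1 t| = `|f2 t|) &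
        (forall nu : R[i], `|nu| = 1 ->
            iint (fun t => (sqmod (f1 t - nu * f2 t))%:E) <> 0%E)].
Proof.
move=> d0 [/borel_funP mg goo] _ uB.
have ig : sqint g by [].
have [i vlong] := long_dual_vector d0 uB.
(* For a null window the pair built from [g] would vanish almost everywhere, hence the cube. *)
pose h := if rint (fun t => g t ^+ 2) == 0 then @cube R d else g.
have ih : sqint h by rewrite /h; case: ifP => // _; exact: sqint_cube.
have h0 : 0 < rint (fun t => h t ^+ 2).
  rewrite /h; case: ifPn => [_|g0]; first by rewrite rint_cube.
  by rewrite lt_def g0; apply: rint_ge0 => t; exact: sqr_ge0.
have [n tail] : exists n, rint (fun t => h t ^+ 2) -
    rint (fun t => h t ^+ 2 * slab i n t) < rint (fun t => h t ^+ 2) / 8.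
  apply: slab_exhausts; [exact: sqint_absint|by move=> t; exact: sqr_ge0|].
  by rewrite divr_gt0.
(* The length [2 n] is the separation that [correlation_lt] asks for. *)
have [v vn vint] := vlong (2 * n%:R).
have n1 : `|1 : R| = 1 by exact: normr1.
have nN1 : `|-1 : R| = 1 by rewrite normrN1.
exists (conj_pair h 1 v), (conj_pair h (-1) v); split.
- exact: L2_conj_pair.
- exact: L2_conj_pair.
- move=> k l; have [m wv] := vint l.
  rewrite /h; case: ifPn => [/eqP g0|_]; last exact: (norm_stft_conj_pair ig (latpt A k) wv).
  rewrite !stft_eq0//; try exact: (sqint_refl 0 (sqint_cube d));
    exact: sqintZ (sqint_refl v (sqint_cube d)).
- by move=> t; rewrite !norm_complexE !sqmod_conj_pair.
- move=> nu nu1; apply: conj_pair_not_proportional => //.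
  exact: correlation_lt tail.
Qed.
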